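(* In the team-design model described in the context, suppose $f$ is convex with $0<f'(1)<1/2$. Then there exists $\bar\rho$ such that the organization's optimal team size (the minimizer of $L_\rho(k)$ over $k\in[1,\infty)$) is strictly decreasing in the attention capacity $\rho$ for all $\rho<\bar\rho$, and equal to $1$ for all $\rho\ge\bar\rho$.
   Context: Model. $W_0$ is a mean-zero Gaussian process on $[0,1]$ (task states) with symmetric, continuous, positive definite covariance kernel $C(x,x')$ and $\int_0^1 C(x,x)\,dx<\infty$. Let $\lambda_1\ge\lambda_2\ge\dots>0$ be the strictly positive eigenvalues (with multiplicity) of the covariance operator $g\mapsto\int_0^1 C(\cdot,x')g(x')\,dx'$; it is assumed that there are infinitely many of them, and $\sum_i\lambda_i=\int_0^1C(x,x)dx<\infty$. The function $f:[1,\infty)\to\mathbb R$ is strictly increasing and differentiable, with $f(1)=1$ and $\lim_{k\to\infty}f(k)=\infty$. The organization chooses a team size $k\in[1,\infty)$. The adaptation loss is $\mathbb E\int_0^1\frac{f(k)}2W_0(x)^2dx=\frac{f(k)}2\sum_i\lambda_i$. The team-state process is $W_1(u)=W_0(ku)/2$ on $[0,1/k]$ (covariance eigenvalues $\lambda_i/(4k)$). Headquarters has attention capacity $\rho>0$: it chooses a signal process $S$ with mutual information $I(W_1;S)\le\rho$ and incurs coordination loss $\mathbb E\int_0^{1/k}(W_1(x)-\mathbb E[W_1(x)\mid S])^2dx$. With the optimal signal the coordination loss equals $\frac1{4k}\big(n\mu^*+\sum_{i>n}\lambda_i\big)$, where $\mu^*=\mu^*(\rho)>0$ is the unique number with $\frac12\sum_i\max\{0,\log(\lambda_i/\mu^*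 )\}=\rho$ and $n=\#\{i:\lambda_i>\mu^*\}$ (neither depends on $k$). The organization therefore chooses $k\in[1,\infty)$ to minimize $$L_\rho(k)=\frac1{4k}\Big(n\mu^*+\sum_{i=n+1}^\infty\lambda_i\Big)+\frac{f(k)}2\sum_{i=1}^\infty\lambda_i .$$ *)

(* Defs.v *)
From mathcomp Require Import all_boot all_order all_algebra.
From mathcomp Require Import finmap.
From mathcomp Require Import all_classical all_reals all_analysis.

Set Implicit Arguments.
Unset Strict Implicit.
Unset Printing Implicit Defensive.

Import Order.TTheory GRing.Theory Num.Theory.
Import numFieldNormedType.Exports.

Local Open Scope classical_set_scope.
Local Open Scope ring_scope.

(* The set of task states is [0, 1]; processes, kernels and functions are total
   on R, and only their restrictions to [0, 1] are constrained. *)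

(* Point masses count as (degenerate) normal laws.  They are written apart
   because [normal_prob m 0] is not the point mass at m. *)
Definition is_normal (d : measure_display) (T : measurableType d)
    (R : realType) (P : probability T R) (X : T -> R) : Prop :=
  exists m s : R, forall A : set R, measurable A ->
    P (X @^-1` A) = if s == 0 then \d_m A else normal_prob m s A.

Definition gaussian_process (d : measure_display) (T : measurableType d)
    (R : realType) (P : probability T R) (D : set R)
    (W : R -> {RV P >-> R}) : Prop :=
  forall (n : nat) (x a : 'I_n -> R), (forall i, D (x i)) ->
    is_normal P (fun w => \sum_(i < n) a i * W (x i) w).

(* Positive definite in the sense of covariance kernels: the quadratic forms
   are nonnegative, not necessarily positive. *)
Definition positive_definite_kernel (R : realType) (D : set R)
    (C : R -> R -> R) : Prop :=
  forall (n : nat) (x a : 'I_n -> R), (forall i, D (x i)) ->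
    0 <= \sum_(i < n) \sum_(j < n) a i * a j * C (x i) (x j).

Definition covariance_operator (R : realType) (C : R -> R -> R)
    (g : R -> R) : R -> R :=
  fun x => \int[lebesgue_measure]_(y in `[0, 1]) (C x y * g y).

(* L^2([0, 1]) is handled through representatives: equality of two elements is
   equality almost everywhere on [0, 1]. *)
Definition square_integrable (R : realType) (g : R -> R) : Prop :=
  measurable_fun (`[0, 1]%classic : set R) g /\
  (@lebesgue_measure R).-integrable `[0, 1] (fun x => (g x ^+ 2)%:E).

Definition kernel_eigenspace (R : realType) (C : R -> R -> R) (t : R) :
    set (R -> R) :=
  [set g | square_integrable g /\
    (covariance_operator C g = (fun x => t * g x)
       %[ae (@lebesgue_measure R) in `[0, 1]%classic])].

Definition kernel_eigenspace_dim (R : realType) (C : R -> R -> R) (t : R)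
    (m : nat) : Prop :=
  exists e : 'I_m -> R -> R,
    [/\ forall i, kernel_eigenspace C t (e i),
        forall a : 'I_m -> R,
          ((fun x => \sum_(i < m) a i * e i x) = cst 0
             %[ae (@lebesgue_measure R) in `[0, 1]%classic]) ->
          forall i, a i = 0
      & forall g, kernel_eigenspace C t g -> exists a : 'I_m -> R,
          (g = (fun x => \sum_(i < m) a i * e i x)
             %[ae (@lebesgue_measure R) in `[0, 1]%classic])].

(* lambda i stands for the (i+1)-st largest positive eigenvalue.  A positive t
   that is not an eigenvalue is covered by the case m = 0. *)
Definition positive_spectrum (R : realType) (C : R -> R -> R)
    (lambda : R^nat) : Prop :=
  [/\ forall i, 0 < lambda i,
      nonincreasing_seq lambda
    & forall t, 0 < t -> exists2 m, kernel_eigenspace_dim C t m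
        & ([set i | lambda i = t] #= `I_m)%card].

Definition water_level (R : realType) (lambda : R^nat) (rho : R) : R :=
  xget 0 [set mu | 0 < mu /\
    (2^-1%:E * \sum_(0 <= i <oo) (Num.max 0 (ln (lambda i / mu)))%:E
       = rho%:E)%E].

Definition num_above (R : realType) (lambda : R^nat) (mu : R) : nat :=
  #|` fset_set [set i | mu < lambda i] |%fset.

(* As lambda is indexed from 0, its tail after the first n terms starts at
   index n. *)
Definition team_loss (R : realType) (lambda : R^nat) (f : R -> R)
    (rho k : R) : R :=
  let mu := water_level lambda rho in
  let n := num_above lambda mu in
  (4 * k)^-1 *
    (n%:R * mu + fine (\sum_(n <= i <oo) (lambda i)%:E)%E)
  + f k / 2 * fine (\sum_(0 <= i <oo) (lambda i)%:E)%E.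

Definition optimal_team_sizes (R : realType) (lambda : R^nat) (f : R -> R)
    (rho : R) : set R :=
  [set k | 1 <= k /\
    forall k', 1 <= k' -> team_loss lambda f rho k <= team_loss lambda f rho k'].

(* Main.v *)
(* By reverse water-filling, with S the sum of the eigenvalues, the loss is
   a / (4 k) + S f(k) / 2, where a = S - sum_i max(0, lambda_i - mu) and the water
   level mu solves sum_i max(0, ln lambda_i - ln mu) = 2 rho.  Both sums are
   strictly decreasing in mu below lambda_0, so a is strictly decreasing in rho.
   The loss is strictly convex in k with right derivative -a / 4 + S f'(1) / 2 at
   k = 1, so k = 1 is optimal exactly when a <= 2 S f'(1); rho_bar is the capacity
   at which equality holds, and it exists because 0 < 2 S f'(1) < S.  Below
   rho_bar the optimum is interior, and the first-order condition there cannot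
   hold for two different values of a. *)
Require Import Defs.
From mathcomp Require Import all_boot all_order all_algebra.
From mathcomp Require Import all_classical all_reals all_analysis.
From mathcomp Require Import ring lra.

Set Implicit Arguments.
Unset Strict Implicit.
Unset Printing Implicit Defensive.

Import Order.TTheory GRing.Theory Num.Theory.
Import numFieldNormedType.Exports.

Local Open Scope classical_set_scope.
Local Open Scope ring_scope.

Lemma convex_function_itvcy (R : realType) (f : R -> R) (a : R) :
  convex_function (`[a, +oo[%classic : set R) f ->
  forall x y t, a <= x -> a <= y -> 0 <= t <= 1 ->
    f (t * x + (1 - t) * y) <= t * f x + (1 - t) * f y.
Proof.
move=> cf x y t ax ay /andP[t0 t1].
by apply: (cf (Itv01 t0 t1) x y); apply: mem_set; rewrite /= in_itv/= andbT.
Qed.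

(** * Choice of the team size for a fixed residual variance *)

Section team_size.
Context {R : realType} (f : R -> R).
Hypothesis f_convex : forall x y t : R, 1 <= x -> 1 <= y -> 0 <= t <= 1 ->
  f (t * x + (1 - t) * y) <= t * f x + (1 - t) * f y.
Hypothesis f_incr : forall x y, 1 <= x -> x < y -> f x < f y.
Hypothesis f_diff : forall x, 1 < x -> derivable f x 1.
Hypothesis f_lim : f k @[k --> +oo] --> +oo.
Variable f'1 : R.
Hypothesis f_diff1 : h^-1 * (f (1 + h) - f 1) @[h --> 0^'+] --> f'1.

(** [s] is the total variance and [a] the variance left after the optimal signal; the attention
    capacity acts on the loss only through [a]. *)
Definition team_cost (s a k : R) : R := (4 * k)^-1 * a + f k / 2 * s.

Definition is_optimal (s a k : R) : Prop :=
  1 <= k /\ forall k', 1 <= k' -> team_cost s a k <= team_cost s a k'.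

(** To the right of 1, [f] is squeezed between the constant [f 1] and its chord over [1, 2]. This
    covers the endpoint, where [f_diff] says nothing. *)
Lemma convex_right_continuous : f x @[x --> 1^'+] --> f 1.
Proof.
apply: (@squeeze_cvgr _ _ _ _ (cst (f 1))
  (fun x => (x - 1) * f 2 + (1 - (x - 1)) * f 1)).
- near=> x.
  have x1 : 1 < x by near: x; exact: nbhs_right_gt.
  have x2 : x < 2 by near: x; apply: nbhs_right_lt; lra.
  rewrite /= ltW ?f_incr//=.
  have := @f_convex 2 1 (x - 1).
  have -> : (x - 1) * 2 + (1 - (x - 1)) * 1 = x by ring.
  by apply; lra.
- exact: cvg_cst.
- apply: cvg_at_right_filter.
  rewrite [X in _ --> X](_ : f 1 = (1 - 1) * f 2 + (1 - (1 - 1)) * f 1); last by ring.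
  apply: cvgD; apply: cvgMl.
    by apply: cvgB; [exact: cvg_id|exact: cvg_cst].
  apply: cvgB; first exact: cvg_cst.
  by apply: cvgB; [exact: cvg_id|exact: cvg_cst].
Unshelve. all: by end_near. Qed.

(** Chord slopes from 1 grow with the other endpoint, so the quotient at a small [h] is at most the
    slope of the chord to [k]; let [h] tend to 0. *)
Lemma convex_tangent_le k : 1 <= k -> f'1 * (k - 1) <= f k - f 1.
Proof.
rewrite le_eqVlt => /predU1P[<-|k1]; first by rewrite !subrr mulr0.
have k10 : 0 < k - 1 by rewrite subr_gt0.
rewrite -ler_pdivlMr//.
apply: (cvgr_to_le f_diff1).
near=> h.
have h0 : 0 < h by near: h; exact: nbhs_right_gt.
have hk : h < k - 1 by near: h; exact: nbhs_right_lt.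
rewrite ler_pdivrMl//.
have := @f_convex k 1 (h / (k - 1)).
have -> : h / (k - 1) * k + (1 - h / (k - 1)) * 1 = 1 + h.
  by field; lra.
have t01 : 0 <= h / (k - 1) <= 1.
  by rewrite divr_ge0 ?ler_pdivrMr ?mul1r//; lra.
move=> /(_ (ltW k1) (lexx _) t01) fh.
rewrite [_ / (k - 1)]mulrC mulrA; lra.
Unshelve. all: by end_near. Qed.

Lemma optimal_exists s a : 0 < s -> 0 < a -> exists k, is_optimal s a k.
Proof.
move=> s0 a0.
(* Coercivity: past [M] the adaptation term alone is at least the cost of [k = 1], so minimizing
   over the compact [1, M] is enough. *)
have [M [M1 fM]] : exists M, 1 < M /\
    forall k, M <= k -> team_cost s a 1 * 2 / s <= f k.
  have /cvgryPge/(_ (team_cost s a 1 * 2 / s)) [N [_ HN]] := f_lim.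
  exists (Num.max 2 (N + 1)); split; first by rewrite lt_max; apply/orP; left; lra.
  by move=> k; rewrite ge_max => /andP[_ Nk]; apply: HN; lra.
have cost_cont : {within `[1, M], continuous (team_cost s a)}.
  have fc x : 1 < x -> {for x, continuous f}.
    by move=> /f_diff/derivable1_diffP/differentiable_continuous.
  have loss_cont (F : set_system R) : Filter F ->
      forall x : R, 1 <= x -> id @ F --> x -> f @ F --> f x ->
      team_cost s a @ F --> team_cost s a x.
    move=> FF x x1 Fx Ff; apply: cvgD; apply: cvgMl.
      apply: cvgV; first by lra.
      by apply: cvgMr.
    by apply: cvgMl.
  apply/continuous_within_itvP => //; split.
  - move=> x; rewrite in_itv/= => /andP[x1 xM].
    by apply: loss_cont; [exact: ltW|exact: cvg_id|exact: fc].
  - apply: loss_cont; [exact: lexx|exact: cvg_at_right_filter|].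
    exact: convex_right_continuous.
  - apply: loss_cont; [exact: ltW|exact: cvg_at_left_filter|].
    by apply: cvg_at_left_filter; exact: fc.
have [k + kmin] := EVT_min (ltW M1) cost_cont.
rewrite in_itv/= => /andP[k1 kM]; exists k; split => // k' k'1.
have [k'M|/ltW k'M] := leP k' M; first by apply: kmin; rewrite in_itv/= k'1.
apply: (@le_trans _ _ (team_cost s a 1)).
  by apply: kmin; rewrite in_itv/= lexx ltW.
have := fM _ k'M; rewrite ler_pdivrMr// => fk'.
have : 0 < (4 * k')^-1 * a by rewrite mulr_gt0// invr_gt0; lra.
by move: fk'; rewrite [team_cost s a k']/team_cost; lra.
Qed.

(** The midpoint of two distinct minimizers would cost strictly less, since 1/k is strictly convex
    and [f] is convex. *)
Lemma optimal_unique s a k k' : 0 < s -> 0 < a ->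
  is_optimal s a k -> is_optimal s a k' -> k = k'.
Proof.
move=> s0 a0.
wlog kk' : k k' / k < k'.
  move=> wl ok ok'; have [|k'k|//] := ltgtP k k'; first by move/wl; apply.
  by apply/esym; exact: wl.
move=> [k1 ok] [k'1 ok'].
have := ok k' k'1; have := ok ((k + k') / 2) ltac:(lra).
have := ok' ((k + k') / 2) ltac:(lra).
have := @f_convex k k' 2^-1 k1 k'1 ltac:(lra).
rewrite /team_cost.
have -> : 2^-1 * k + (1 - 2^-1) * k' = (k + k') / 2 by field.
set m := (k + k') / 2 => fm.
have : (4 * m)^-1 * a < ((4 * k)^-1 * a + (4 * k')^-1 * a) / 2.
  rewrite -subr_gt0.
  have -> : ((4 * k)^-1 * a + (4 * k')^-1 * a) / 2 - (4 * m)^-1 * a =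
     a * (k' - k) ^+ 2 / (8 * k * k' * (k + k')).
    by rewrite /m; field; lra.
  by do ![apply: divr_gt0|apply: mulr_gt0|apply: exprn_gt0]; lra.
have : f m / 2 * s <= (f k / 2 * s + f k' / 2 * s) / 2.
  have -> : (f k / 2 * s + f k' / 2 * s) / 2 =
      (2^-1 * f k + (1 - 2^-1) * f k') / 2 * s by field.
  by rewrite ler_wpM2r//; lra.
lra.
Qed.

(** Both terms lie above their tangents at 1, and the slopes of these tangents, -a/4 and s f'(1)/2,
    have a nonnegative sum. *)
Lemma optimal_eq1 s a : 0 < s -> 0 < a -> a <= 2 * s * f'1 -> is_optimal s a 1.
Proof.
move=> s0 a0 aS; split => // k k1.
have tan := convex_tangent_le k1.
rewrite -subr_ge0 /team_cost.
have : s / 2 * (f'1 * (k - 1)) <= s / 2 * (f k - f 1) by rewrite ler_wpM2l//; lra.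
have : a / 4 * (k - 1) <= s / 2 * (f'1 * (k - 1)).
  have -> : s / 2 * (f'1 * (k - 1)) = (2 * s * f'1) / 4 * (k - 1) by field.
  by rewrite ler_wpM2r//; lra.
have : 0 <= (4 * k)^-1 * a - (4 * 1)^-1 * a + a / 4 * (k - 1).
  have -> : (4 * k)^-1 * a - (4 * 1)^-1 * a + a / 4 * (k - 1) =
      a * (k - 1) ^+ 2 / (4 * k).
    by field; lra.
  by rewrite divr_ge0 ?mulr_ge0 ?sqr_ge0//; lra.
lra.
Qed.

(** If 1 were optimal, comparing it with 1 + h would bound the difference quotient of [f] below by a
    / (2 s (1 + h)), and the limit would give a / (2 s) <= f'(1). *)
Lemma optimal_gt1 s a k : 0 < s -> 2 * s * f'1 < a -> is_optimal s a k -> 1 < k.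
Proof.
move=> s0 aS [k1 ok]; rewrite lt_neqAle k1 andbT; apply/eqP => k_eq1.
move: ok; rewrite -k_eq1 => ok.
suff : a / (2 * s) <= f'1 by rewrite ler_pdivrMr; lra.
suff H : \forall h \near 0^'+, a / (2 * s * (1 + h)) <= h^-1 * (f (1 + h) - f 1).
  apply: ler_cvg_to (f_diff1) H.
  apply: cvg_at_right_filter; apply: cvgMr; apply: cvgV; first lra.
  rewrite [X in _ --> X](_ : _ = 2 * s * (1 + 0)); last by ring.
  by apply: cvgMr; apply: cvgD; [exact: cvg_cst|exact: cvg_id].
near=> h.
have h0 : 0 < h by near: h; exact: nbhs_right_gt.
have := ok (1 + h) ltac:(lra); rewrite /team_cost => cost_h.
rewrite -subr_ge0.
have -> : h^-1 * (f (1 + h) - f 1) - a / (2 * s * (1 + h)) =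
    ((4 * (1 + h))^-1 * a + f (1 + h) / 2 * s
     - ((4 * 1)^-1 * a + f 1 / 2 * s)) * 2 / (h * s).
  by field; lra.
by rewrite divr_ge0 ?mulr_ge0 ?subr_ge0//; lra.
Unshelve. all: by end_near. Qed.

Lemma optimal_decreasing s a1 a2 k1 k2 : a2 < a1 -> 1 < k2 ->
  is_optimal s a1 k1 -> is_optimal s a2 k2 -> k2 < k1.
Proof.
move=> a21 k2_gt1 [k1_ge1 o1] [k2_ge1 o2].
have := o1 _ k2_ge1; have := o2 _ k1_ge1; rewrite /team_cost => h1 h2.
have [k12|//|k12] := ltgtP k1 k2.
  (* Adding the two optimality inequalities cancels the [f] terms and makes this product
     nonpositive. *)
  suff : 0 < ((4 * k1)^-1 - (4 * k2)^-1) * (a1 - a2) by lra.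
  by rewrite mulr_gt0 ?subr_gt0// ltf_pV2 ?posrE; lra.
(* If k2 were optimal for both a1 and a2, the derivative at k2 of the
   difference of the two costs, (a1 - a2) / (4 x), would vanish. *)
subst k1; exfalso.
have dcost a x : 1 < x -> derivable (team_cost s a) x 1.
  move=> x1; apply: derivableD; apply: derivableM => //.
    apply: derivableV; first lra.
    by apply: derivableM.
  by apply: derivableM => //; exact: f_diff.
have crit a : (forall k', 1 <= k' -> team_cost s a k2 <= team_cost s a k') ->
    is_derive k2 1 (team_cost s a) 0.
  move=> oa; apply: (@derive1_at_min _ _ 1 (k2 + 1)); first lra.
  - by move=> t; rewrite in_itv/= => /andP[t1 _]; exact: dcost.
  - by rewrite in_itv/=; lra.
  - by move=> t; rewrite in_itv/= => /andP[t1 _]; apply: oa; exact: ltW.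
have dzero : is_derive k2 1 (team_cost s a1 - team_cost s a2) (0 - 0).
  by apply: is_deriveB; exact: crit.
have dinv : is_derive k2 1 ((a1 - a2) \*: (fun x : R => ((4 \*: @id R) x)^-1))
    ((a1 - a2) *: (- (4 *: k2) ^- 2 *: (4 *: 1))).
  apply: is_deriveZ; apply: is_deriveV.
  by rewrite /= /GRing.scale/= lt0r_neq0//; lra.
have diffE : (a1 - a2) \*: (fun x : R => ((4 \*: @id R) x)^-1) =
    team_cost s a1 - team_cost s a2.
  by apply/funext => x; rewrite /team_cost !fctE/= /GRing.scale/=; ring.
rewrite diffE in dinv.
have := @derive_val _ _ _ _ _ _ _ dinv.
rewrite (@derive_val _ _ _ _ _ _ _ dzero) subr0 /GRing.scale/= mulr1 => /esym/eqP.
rewrite !mulf_eq0 oppr_eq0 invr_eq0 expf_eq0/=; lra.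
Qed.

End team_size.

(* For phi = ln this is twice the mutual information spent by water-filling at
   level mu; for phi = id it is the variance removed by the signal, before the 1/(4 k) scaling. *)
Definition excess (R : realType) (l : R^nat) (phi : R -> R) (mu : R) : R :=
  \sum_(0 <= i < num_above l mu) (phi (l i) - phi mu).

Lemma ln_increasing (R : realType) (x y : R) : 0 < x -> x < y -> ln x < ln y.
Proof. by move=> x0 xy; rewrite ltr_ln// posrE// (lt_trans x0). Qed.

(** * Water-filling: the excess as a function of the water level *)

Section attention.
Context {R : realType} (l : R^nat).
Hypothesis l_gt0 : forall i, 0 < l i.
Hypothesis l_noninc : nonincreasing_seq l.
Hypothesis l_sum : (\sum_(0 <= i <oo) (l i)%:E < +oo)%E.

Let S : R := fine (\sum_(0 <= i <oo) (l i)%:E)%E.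

Let l_ge0 i : (0 <= (l i)%:E)%E.
Proof. by rewrite lee_fin ltW. Qed.

Lemma fineK_sum : (\sum_(0 <= i <oo) (l i)%:E)%E = S%:E.
Proof.
rewrite fineK// ge0_fin_numE//.
by apply: nneseries_ge0 => i *; exact: l_ge0.
Qed.

Lemma partial_sum_le N : \sum_(0 <= i < N) l i <= S.
Proof.
rewrite -lee_fin -fineK_sum -sumEFin.
by apply: nneseries_lim_ge => i *; exact: l_ge0.
Qed.

Lemma partial_sum_gt t : t < S -> exists N, t < \sum_(0 <= i < N) l i.
Proof.
move=> tS; apply: contrapT => /forallNP H.
move: tS; apply/negP; rewrite -leNgt -lee_fin -fineK_sum.
apply: lime_le; first by apply: is_cvg_nneseries => i *; exact: l_ge0.
near=> N; rewrite sumEFin lee_fin leNgt; apply/negP; exact: H.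
Unshelve. all: by end_near. Qed.

Lemma tail_sum n :
  fine (\sum_(n <= i <oo) (l i)%:E)%E = S - \sum_(0 <= i < n) l i.
Proof.
have split_n : (\sum_(0 <= i <oo) (l i)%:E =
    \sum_(0 <= i < n) (l i)%:E + \sum_(n <= i <oo) (l i)%:E)%E.
  exact: (@nneseries_split _ (fun i => (l i)%:E) 0 n).
have tail_fin : (\sum_(n <= i <oo) (l i)%:E)%E \is a fin_num.
  rewrite ge0_fin_numE; last by apply: nneseries_ge0 => i *; exact: l_ge0.
  apply: le_lt_trans l_sum; rewrite split_n leeDr//.
  by rewrite sumEFin lee_fin sumr_ge0// => i _; rewrite ltW.
by rewrite /S split_n fineD// sumEFin//= [_ + fine _]addrC addrK.
Qed.

(** Otherwise more than S / t terms, each at least [t], would sum to more than [S]. *)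
Lemma eventually_small t : 0 < t -> exists N, l N <= t.
Proof.
move=> t0; apply: contrapT => /forallNP H.
have lt i : t <= l i by rewrite leNgt; apply/negP => /ltW; exact: H.
have S0 : 0 <= S by have := partial_sum_le 0; rewrite big_nil.
have := partial_sum_le (Num.truncn (S / t)).+1; rewrite leNgt => /negP; apply.
have : (Num.truncn (S / t)).+1%:R * t <= \sum_(0 <= i < (Num.truncn (S / t)).+1) l i.
  rewrite mulr_natl -[X in _ *+ X]subn0 -sumr_const_nat.
  exact: ler_sum_nat.
by apply: lt_le_trans; rewrite -ltr_pdivrMr// truncnS_gt.
Qed.

(** By monotonicity the indices above a positive level form an initial segment, finite because the
    terms become small; hence [fset_set] returns the actual set. *)
Lemma num_aboveP mu i : 0 < mu -> (i < num_above l mu)%N = (mu < l i).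
Proof.
move=> mu0; have /ex_minnP[n ln nmin] := eventually_small mu0.
suff H j : (j < n)%N = (mu < l j).
  rewrite /num_above (_ : [set j | mu < l j] = `I_n).
    by rewrite (card_fset_set (card_eqxx _)) H.
  by apply/seteqP; split => j /=; rewrite H.
apply/idP/idP => [|muj]; last first.
  by rewrite ltnNge; apply/negP => /l_noninc; lra.
by apply: contraTT; rewrite -leNgt -leqNgt; exact: nmin.
Qed.

Lemma num_above_anti mu nu : 0 < mu -> mu <= nu ->
  (num_above l nu <= num_above l mu)%N.
Proof.
move=> mu0 munu; rewrite leqNgt num_aboveP; last exact: lt_le_trans munu.
apply/negP => /(le_lt_trans munu).
by rewrite -num_aboveP// ltnn.
Qed.

Lemma num_above0 mu : l 0 <= mu -> num_above l mu = 0.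
Proof.
move=> lmu; apply/eqP; rewrite -leqn0 leqNgt num_aboveP -?leNgt//.
exact: lt_le_trans lmu.
Qed.

Section excess.
Variable phi : R -> R.
Hypothesis phi_incr : forall x y, 0 < x -> x < y -> phi x < phi y.
Hypothesis phi_cont : forall x, 0 < x -> {for x, continuous phi}.

Let phi_le x y : 0 < x -> x <= y -> phi x <= phi y.
Proof. by move=> x0; rewrite le_eqVlt => /predU1P[->//|/phi_incr-/(_ x0)/ltW]. Qed.

(** The added terms are zero. A common range [N] allows different levels to be compared term by
    term. *)
Lemma excessE mu N : 0 < mu -> (num_above l mu <= N)%N ->
  excess l phi mu = \sum_(0 <= i < N) Num.max 0 (phi (l i) - phi mu).
Proof.
move=> mu0 nN; rewrite (big_cat_nat _ nN)//= [X in _ + X]big_nat.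
rewrite [X in _ + X]big1 ?addr0.
  apply: eq_big_nat => i /andP[_]; rewrite num_aboveP// => /phi_incr-/(_ mu0) mui.
  by rewrite max_r// subr_ge0 ltW.
move=> i /andP[]; rewrite leqNgt num_aboveP// -leNgt => /phi_le-/(_ (l_gt0 i)) lmu _.
by rewrite max_l// subr_le0.
Qed.

Lemma excess_eq0 mu : l 0 <= mu -> excess l phi mu = 0.
Proof. by move=> lmu; rewrite /excess num_above0// big_nil. Qed.

(** Over the longer range, that of [mu], no term increases with the level, and the first one drops
    strictly because [mu < l 0]. *)
Lemma excess_decr mu nu : 0 < mu -> mu < nu -> mu < l 0 ->
  excess l phi nu < excess l phi mu.
Proof.
move=> mu0 munu mul0; have nu0 := lt_trans mu0 munu.
have := num_above_anti mu0 (ltW munu).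
move=> /(excessE nu0)->; rewrite (excessE mu0 (leqnn _)).
have n0 : (0 < num_above l mu)%N by rewrite num_aboveP.
rewrite [ltLHS]big_ltn// [ltRHS]big_ltn//; apply: ltr_leD.
  have := phi_incr mu0 mul0; have := phi_incr mu0 munu => ? ?.
  by rewrite lt_max !gt_max; apply/orP; right; apply/andP; split; lra.
apply: ler_sum_nat => i _; apply: le_max2 => //.
by rewrite lerD2l lerN2 ltW// phi_incr.
Qed.

Lemma excess_anti mu nu : 0 < mu -> mu <= nu -> excess l phi nu <= excess l phi mu.
Proof.
move=> mu0; rewrite le_eqVlt => /predU1P[->//|munu].
have [/(excess_decr mu0 munu)/ltW//|lmu] := ltP mu (l 0).
by rewrite !excess_eq0// (le_trans lmu)// ltW.
Qed.

Lemma excess_IVT a t : 0 < a -> a <= l 0 -> 0 <= t <= excess l phi a ->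
  exists mu, a <= mu <= l 0 /\ excess l phi mu = t.
Proof.
move=> a0 al0 /andP[t0 ta].
(* For levels above [a], the range [num_above l a] serves for all of them, so the excess is a fixed
   finite sum of continuous functions. *)
pose F N mu := \sum_(0 <= i < N) Num.max 0 (phi (l i) - phi mu).
have eF mu : a <= mu -> excess l phi mu = F (num_above l a) mu.
  by move=> amu; apply: excessE; [exact: lt_le_trans amu|exact: num_above_anti].
have cF N mu : 0 < mu -> {for mu, continuous (F N)}.
  move=> mu0; elim: N => [|N IH].
    rewrite (_ : F 0 = cst 0); last by apply/funext => x; rewrite /F big_nil.
    exact: cvg_cst.
  rewrite (_ : F N.+1 = F N \+ (cst 0 \max (fun nu => phi (l N) - phi nu))).
    apply: cvgD => //; apply: continuous_max; first exact: cvg_cst.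
    by apply: cvgB; [exact: cvg_cst|exact: phi_cont].
  by apply/funext => x; rewrite /F big_nat_recr.
have [||mu] := @IVT _ (F (num_above l a)) a (l 0) t al0.
- apply: continuous_in_subspaceT => x /set_mem; rewrite /= in_itv/= => /andP[ax _].
  by apply: cF; exact: lt_le_trans ax.
- by rewrite -!eF// (@excess_eq0 (l 0))// ge_min le_max t0 ta orbT.
- rewrite in_itv/= => /andP[amu mul0] <-; exists mu.
  by rewrite amu mul0 eF.
Qed.

End excess.

Lemma rate_sumE mu : 0 < mu ->
  (2^-1%:E * \sum_(0 <= i <oo) (Num.max 0 (ln (l i / mu)))%:E
   = (2^-1 * excess l (@ln R) mu)%:E)%E.
Proof.
move=> mu0; rewrite (@nneseries_split _ _ 0 (num_above l mu)); last first.
  by move=> i _; rewrite lee_fin le_max lexx.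
rewrite add0n sumEFin eseries0 ?adde0 => [|i]; last first.
  rewrite leqNgt num_aboveP// -leNgt => lmu _.
  by rewrite max_l// ln_le0// ler_pdivrMr// mul1r.
rewrite -EFinM (excessE (@ln_increasing R) mu0 (leqnn _)); congr (_ * _)%:E.
by apply: eq_bigr => i _; rewrite ln_div ?posrE.
Qed.

(** For positive capacity the set defining the water level is inhabited, so the default 0 of [xget]
    is never returned. *)
Lemma water_levelP rho : 0 < rho -> 0 < water_level l rho < l 0 /\
  excess l (@ln R) (water_level l rho) = 2 * rho.
Proof.
move=> rho0; rewrite /water_level; set A := [set mu | _].
have [mu0] : A (xget 0 A).
  (* At this level the first term alone, ln (l 0) - ln a, equals 2 rho. *)
  apply: xgetPex; pose a := l 0 * expR (- (2 * rho)).
  have a0 : 0 < a by rewrite mulr_gt0// expR_gt0.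
  have al0 : a < l 0 by rewrite gtr_pMr// expR_lt1; lra.
  have [|mu [/andP[amu mul0] emu]] :=
      @excess_IVT _ (@ln_increasing R) (@continuous_ln R) _ (2 * rho) a0 (ltW al0).
    apply/andP; split; first by lra.
    have n0 : (0 < num_above l a)%N by rewrite num_aboveP.
    rewrite (excessE (@ln_increasing R) a0 (leqnn _)) big_ltn//.
    have : 2 * rho <= Num.max 0 (ln (l 0) - ln a).
      by rewrite le_max lnM ?posrE ?expR_gt0// expRK; apply/orP; right; lra.
    move=> /le_trans; apply; rewrite lerDl; apply: sumr_ge0 => i _.
    by rewrite le_max lexx.
  have mu0 : 0 < mu by exact: lt_le_trans amu.
  by exists mu; split => //; rewrite rate_sumE// emu; congr _%:E; field.
rewrite rate_sumE// => -[] erho; rewrite mu0/=.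
have e2 : excess l (@ln R) (xget 0 A) = 2 * rho by rewrite -erho; field.
split=> //; rewrite ltNge; apply/negP => /excess_eq0 e0.
by move: e2; rewrite e0; lra.
Qed.

Lemma team_loss_excess f rho k : team_loss l f rho k =
  (4 * k)^-1 * (S - excess l id (water_level l rho)) + f k / 2 * S.
Proof.
rewrite /team_loss tail_sum -/S /excess big_split/= sumrN sumr_const_nat subn0.
by rewrite mulr_natl; congr (_ * _ + _); ring.
Qed.

(** The first term not above the level is positive and is left out of the excess. Hence the residual
    variance stays positive. *)
Lemma excess_lt_sum mu : 0 < mu -> excess l id mu < S.
Proof.
move=> mu0; apply: lt_le_trans (partial_sum_le (num_above l mu).+1).
rewrite big_nat_recr//= -[ltLHS]addr0 ler_ltD//.
by apply: ler_sum_nat => i _; rewrite gerBl ltW.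
Qed.

Lemma excess_reaches t : 0 < t < S ->
  exists mu, 0 < mu < l 0 /\ excess l id mu = t.
Proof.
move=> /andP[t0 /partial_sum_gt[N tN]].
set P := \sum_(0 <= i < N) l i in tN.
have id_incr := fun (x y : R) (_ : 0 < x) (xy : x < y) => xy.
(* The first [N] terms lose at most N a <= P - t, so the excess at [a] still reaches [t]. The
   successor avoids a zero denominator, and the minimum keeps [a] within the range of
   [excess_IVT]. *)
pose a := Num.min (l 0) ((P - t) / N.+1%:R).
have a0 : 0 < a by rewrite lt_min l_gt0 divr_gt0// subr_gt0.
have al0 : a <= l 0 by rewrite ge_min lexx.
have ta : t <= excess l id a.
  rewrite (excessE id_incr a0 (leq_maxl _ N)) (big_cat_nat _ (leq_maxr _ N))//=.
  apply: (@le_trans _ _ (\sum_(0 <= i < N) (l i - a))).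
    rewrite big_split/= sumrN sumr_const_nat subn0 -mulr_natr.
    have : a * N.+1%:R <= P - t by rewrite -ler_pdivlMr// ge_min lexx orbT.
    by rewrite -natr1 -/P; lra.
  rewrite -[leLHS]addr0 lerD//.
    by apply: ler_sum_nat => i _; rewrite le_max lexx orbT.
  by apply: sumr_ge0 => i _; rewrite le_max lexx.
have [|mu [/andP[amu mul0] emu]] :=
  excess_IVT id_incr (fun x _ => @cvg_id _ (nbhs x)) a0 al0 (t := t).
  by rewrite ta ltW.
exists mu; split => //; rewrite (lt_le_trans a0 amu) lt_neqAle mul0 andbT /=.
by apply/eqP => mueq; move: emu; rewrite excess_eq0 ?mueq//; lra.
Qed.

End attention.

(** * The threshold capacity and monotonicity in the capacity *)

Theorem theorem1 (R : realType)
  (d : measure_display) (T : measurableType d) (P : probability T R)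
  (W0 : R -> {RV P >-> R}) (C : R -> R -> R) (lambda : R^nat)
  (f : R -> R) (f'1 : R)
  (W0_gaussian : gaussian_process `[0, 1] W0)
  (W0_mean : forall x, 0 <= x <= 1 -> ('E_P[W0 x] = 0)%E)
  (W0_cov : forall x y, 0 <= x <= 1 -> 0 <= y <= 1 ->
     covariance P (W0 x) (W0 y) = (C x y)%:E)
  (C_sym : forall x y, 0 <= x <= 1 -> 0 <= y <= 1 -> C x y = C y x)
  (C_cont : {within `[0, 1] `*` `[0, 1],
     continuous (fun z : R * R => C z.1 z.2)})
  (C_posdef : positive_definite_kernel `[0, 1] C)
  (C_trace : (\int[lebesgue_measure]_(x in `[0%R, 1%R]) (C x x)%:E < +oo)%E)
  (lambda_spectrum : positive_spectrum C lambda)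
  (lambda_trace : (\sum_(0 <= i <oo) (lambda i)%:E =
     \int[lebesgue_measure]_(x in `[0%R, 1%R]) (C x x)%:E)%E)
  (f_incr : forall x y, 1 <= x -> x < y -> f x < f y)
  (f_diff : forall x, 1 < x -> derivable f x 1)
  (f_diff1 : h^-1 * (f (1 + h) - f 1) @[h --> 0^'+] --> f'1)
  (f_1 : f 1 = 1)
  (f_lim : f k @[k --> +oo] --> +oo)
  (f_convex : convex_function (`[1, +oo[%classic : set R) f)
  (f'1_bounds : 0 < f'1 < 2^-1) :
  exists (kstar : R -> R) (rho_bar : R),
    [/\ 0 < rho_bar,
        forall rho, 0 < rho -> optimal_team_sizes lambda f rho = [set kstar rho],
        forall rho1 rho2, 0 < rho1 -> rho1 < rho2 -> rho2 < rho_bar ->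
          kstar rho2 < kstar rho1
      & forall rho, rho_bar <= rho -> kstar rho = 1].
Proof.
have [lambda_gt0 lambda_noninc _] := lambda_spectrum.
have lambda_sum : (\sum_(0 <= i <oo) (lambda i)%:E < +oo)%E.
  by rewrite lambda_trace.
have cvx := convex_function_itvcy f_convex.
set S := fine (\sum_(0 <= i <oo) (lambda i)%:E)%E.
pose w := water_level lambda.
pose cost rho := S - excess lambda id (w rho).
have wP rho : 0 < rho -> 0 < w rho < lambda 0 /\
    excess lambda (@ln R) (w rho) = 2 * rho.
  exact: water_levelP.
have ln_incr := @ln_increasing R.
have id_incr := fun (x y : R) (_ : 0 < x) (xy : x < y) => xy.
have cost_gt0 rho : 0 < rho -> 0 < cost rho.
  by move=> /wP[/andP[w0 _] _]; rewrite subr_gt0 excess_lt_sum.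
have S_gt0 : 0 < S.
  have := @partial_sum_le _ _ lambda_gt0 lambda_sum 1.
  by rewrite big_nat1; apply: lt_le_trans.
have optE rho : optimal_team_sizes lambda f rho = is_optimal f S (cost rho).
  rewrite /optimal_team_sizes /is_optimal; apply/seteqP; split => k /= [k1 ok];
    split=> // k' /ok; by rewrite !team_loss_excess.
(* The level leaving residual variance 2 S f'(1), where [optimal_eq1] and [optimal_gt1] meet; the
   bounds on [f'1] put the target strictly between 0 and [S]. *)
have [mu_bar [/andP[mu_bar0 mu_bar1] mu_barE]] :
    exists mu, 0 < mu < lambda 0 /\ excess lambda id mu = S - 2 * S * f'1.
  apply: excess_reaches => //; rewrite -/S.
  have : 0 < S * f'1 by rewrite mulr_gt0//; lra.
  have : 0 < S * (1 - 2 * f'1) by rewrite mulr_gt0//; lra.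
  lra.
pose rho_bar := excess lambda (@ln R) mu_bar / 2.
have w_anti rho1 rho2 : 0 < rho1 -> rho1 < rho2 -> w rho2 < w rho1.
  move=> rho1_gt0 rho12; have [/andP[w1 _] e1] := wP _ rho1_gt0.
  have [_ e2] := wP _ (lt_trans rho1_gt0 rho12).
  rewrite ltNge; apply/negP.
  by move=> /(excess_anti lambda_gt0 lambda_noninc lambda_sum ln_incr w1); lra.
have cost_anti rho1 rho2 : 0 < rho1 -> rho1 < rho2 -> cost rho2 < cost rho1.
  move=> rho1_gt0 rho12; rewrite ltrD2l ltrN2.
  have [/andP[w2 w2l] _] := wP _ (lt_trans rho1_gt0 rho12).
  by apply: (excess_decr lambda_gt0 lambda_noninc lambda_sum id_incr) => //; exact: w_anti.
have rho_bar_gt0 : 0 < rho_bar.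
  rewrite divr_gt0//
    -(@excess_eq0 _ _ lambda_gt0 lambda_noninc lambda_sum (@ln R) (lambda 0))//.
  exact: excess_decr.
(* The water level at [rho_bar] is [mu_bar], because the logarithmic excess is injective below
   [lambda 0]. *)
have w_bar : excess lambda id (w rho_bar) = S - 2 * S * f'1.
  have [/andP[w0 wl] e] := wP _ rho_bar_gt0.
  rewrite -mu_barE; congr (excess _ _ _).
  have {}e : excess lambda (@ln R) (w rho_bar) = excess lambda (@ln R) mu_bar.
    by rewrite e /rho_bar; field.
  have dec := excess_decr lambda_gt0 lambda_noninc lambda_sum ln_incr.
  have [lt|lt|//] := ltgtP (w rho_bar) mu_bar.
    by have := dec _ _ w0 lt wl; rewrite e ltxx.
  by have := dec _ _ mu_bar0 lt mu_bar1; rewrite e ltxx.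
have cost_bar : cost rho_bar = 2 * S * f'1 by rewrite /cost w_bar; ring.
(* At positive [rho] a minimizer exists, so the default 1 is not what decides the value. *)
pose kstar rho := xget 1 (optimal_team_sizes lambda f rho).
have kstarP rho : 0 < rho -> is_optimal f S (cost rho) (kstar rho).
  move=> rho0.
  have ex : exists k, optimal_team_sizes lambda f rho k.
    rewrite optE.
    exact: (optimal_exists cvx f_incr f_diff f_lim S_gt0 (cost_gt0 _ rho0)).
  by have := xgetPex 1 ex; rewrite -/(kstar rho) optE.
have kstar_unique rho k : 0 < rho -> is_optimal f S (cost rho) k -> k = kstar rho.
  move=> rho0 ok; apply: (optimal_unique cvx S_gt0 (cost_gt0 _ rho0)) => //.
  exact: kstarP.
exists kstar, rho_bar; split => //.
- move=> rho rho0; rewrite optE; apply/seteqP; split => k /=.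
    exact: kstar_unique.
  by move=> ->; exact: kstarP.
- move=> rho1 rho2 rho1_gt0 rho12 rho2_lt.
  have rho2_gt0 := lt_trans rho1_gt0 rho12.
  have o2 := kstarP _ rho2_gt0.
  apply: (optimal_decreasing f_diff (cost_anti _ _ rho1_gt0 rho12) _
    (kstarP _ rho1_gt0) o2).
  (* Only the optimum at the larger capacity must be shown interior: its residual variance still
     exceeds the one at [rho_bar]. *)
  apply: (optimal_gt1 f_diff1 S_gt0 _ o2).
  by rewrite -cost_bar; exact: cost_anti.
- move=> rho rho_ge; have rho0 := lt_le_trans rho_bar_gt0 rho_ge.
  apply/esym; apply: kstar_unique => //.
  apply: (optimal_eq1 cvx f_diff1 S_gt0 (cost_gt0 _ rho0)).
  rewrite -cost_bar; move: rho_ge; rewrite le_eqVlt => /predU1P[->//|lt].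
  by apply: ltW; exact: cost_anti.
Qed.
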